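(* Let $m,n,r$ be positive integers, let $\mathcal{A},\mathcal{B}\in\mathbb{R}^{m\times n\times r}$ and $p=\min\{m,n\}$. The following inequalities hold for the decreasingly ordered (tensor) singular values of $\mathcal{A}$, $\mathcal{B}$, $\mathcal{A}+\mathcal{B}$ and $\mathcal{A}*\mathcal{B}^{\mathrm T}$. For all integers $i,j$ with $1\le i,j\le p$ and $i+j-1\le p$: $$\sigma_{i+j-1}(\mathcal{A}+\mathcal{B})\le\sigma_i(\mathcal{A})+\sigma_j(\mathcal{B}),$$ $$\sigma_{i+j-1}(\mathcal{A}*\mathcal{B}^{\mathrm T})\le r\,\sigma_i(\mathcal{A})\,\sigma_j(\mathcal{B}).$$ For all $i=1,\dots,p$: $$|\sigma_i(\mathcal{A}+\mathcal{B})-\sigma_i(\mathcal{A})|\le\sigma_1(\mathcal{B}),$$ $$\sigma_i(\mathcal{A}*\mathcal{B}^{\mathrm T})\le r\,\sigma_i(\mathcal{A})\,\sigma_1(\mathcal{B}).$$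
   Context: For a third-order tensor $\mathcal{A}\in\mathbb{R}^{m\times n\times r}$, let $A_k=\mathcal{A}(:,:,k)\in\mathbb{R}^{m\times n}$, $k=1,\dots,r$, be its frontal slices. T-product: for $\mathcal{A}\in\mathbb{R}^{m\times n\times r}$ and $\mathcal{B}\in\mathbb{R}^{n\times t\times r}$, $\mathcal{A}*\mathcal{B}\in\mathbb{R}^{m\times t\times r}$ is the tensor whose frontal slices, stacked vertically, form the product of the block-circulant matrix with first block column $(A_1;A_2;\dots;A_r)$ and the stacked matrix $(B_1;B_2;\dots;B_r)$; that is, $(\mathcal{A}*\mathcal{B})_k=\sum_{j=1}^{r}A_{((k-j)\bmod r)+1}B_j$. Transpose: for $\mathcal{A}\in\mathbb{R}^{m\times n\times r}$, $\mathcal{A}^{\mathrm T}\in\mathbb{R}^{n\times m\times r}$ is obtained by transposing each frontal slice and then reversing the order of the transposed slices $2$ through $r$, i.e. $(\mathcal{A}^{\mathrm T})_1=A_1^{\mathrm T}$ and $(\mathcal{A}^{\mathrm T})_k=A_{r+2-k}^{\mathrm T}$ for $2\le k\le r$. Discrete Fourier transform along the third mode: $\hat A_k=\sum_{j=1}^{r}\omega^{(k-1)(j-1)}A_j$ with $\omega=e^{-2\pi \mathtt{i}/r}$, $k=1,\dots,r$. Tensor singular values: $\mathcal{A}$ has a T-SVD $\mathcal{A}=\mathcal{U}*\mathcal{S}*\mathcal{V}^{\mathrm T}$ (with $\mathcal{U},\mathcal{V}$ orthogonal tensors and $\mathcal{S}$ having diagonal frontal slices) in which the diagonal of the $k$-th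 Fourier-transformed frontal slice $\hat{S}_k$ of $\mathcal{S}$ consists of the singular values of the matrix $\hat A_k$ in decreasing order. The singular values of $\mathcal{A}$ are the diagonal entries of the first frontal slice $\mathcal{S}(:,:,1)$. Equivalently, if $\sigma_1(\hat A_k)\ge\cdots\ge\sigma_{\min\{m,n\}}(\hat A_k)\ge 0$ are the ordinary singular values of $\hat A_k$, the $i$-th singular value of $\mathcal{A}$ is $$\sigma_i(\mathcal{A})=\frac1r\sum_{k=1}^{r}\sigma_i(\hat A_k),\qquad i=1,\dots,\min\{m,n\}.$$ *)

(* Defs.v *)
From mathcomp Require Import all_boot all_order all_algebra.
From mathcomp Require Import complex lra.
From mathcomp Require Import reals trigo.

Set Implicit Arguments.
Unset Strict Implicit.
Unset Printing Implicit Defensive.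
Import Order.TTheory GRing.Theory Num.Theory.
Local Open Scope ring_scope.
Local Open Scope sesquilinear_scope.
Local Open Scope complex_scope.

(* An m x n x r.+1 tensor is the family of its frontal slices, indexed from 0.
   The index type 'I_r.+1 is the additive group of integers modulo r.+1, so
   k - j and - k below are computed modulo the number of slices. Addition of
   tensors is the pointwise addition of finite functions. *)
Notation tensor R m n r := {ffun 'I_r.+1 -> 'M[R]_(m, n)}.

Definition tprod (R : pzRingType) (m n t r : nat)
    (A : tensor R m n r) (B : tensor R n t r) : tensor R m t r :=
  [ffun k => \sum_(j < r.+1) A (k - j) *m B j].

Definition ttr (R : Type) (m n r : nat) (A : tensor R m n r) : tensor R n m r :=
  [ffun k => (A (- k))^T].

(* exp(- 2 pi i / r) *)
Definition omega (R : realType) (r : nat) : R[i] :=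
  cos (2 * pi / r%:R) -i* sin (2 * pi / r%:R).

Definition dft (R : realType) (m n r : nat) (A : tensor R m n r)
    (k : 'I_r.+1) : 'M[R[i]]_(m, n) :=
  \sum_(j < r.+1) omega R r.+1 ^+ (k * j) *: map_mx (real_complex R) (A j).

(* The roots of the characteristic polynomial, repeated according to their
   multiplicities. *)
Definition eigenvalues (C : numClosedFieldType) (n : nat) (M : 'M[C]_n) :
    seq C :=
  sval (closed_field_poly_normal (char_poly M)).

(* All n square roots of the eigenvalues of A^* A, in decreasing order; those
   beyond the first minn m n are zero. The eigenvalues are nonnegative reals,
   so taking their real part only changes their type. *)
Definition sing_vals (R : realType) (m n : nat) (A : 'M[R[i]]_(m, n)) :
    seq R :=
  sort >=%R [seq Num.sqrt (complex.Re x) | x <- eigenvalues (A ^t* *m A)].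

(* Singular values are numbered from 1, as usual; i = 0 is meaningless. *)
Definition sigma (R : realType) (m n : nat) (i : nat) (A : 'M[R[i]]_(m, n)) :
    R :=
  (sing_vals A)`_i.-1.

Definition tsigma (R : realType) (m n r : nat) (i : nat)
    (A : tensor R m n r) : R :=
  r.+1%:R^-1 * \sum_(k < r.+1) sigma i (dft A k).

Lemma omegaX (R : realType) (r k : nat) :
  omega R r ^+ k = cos (2 * pi / r%:R *+ k) -i* sin (2 * pi / r%:R *+ k).
Proof.
rewrite /omega; set t := 2 * pi / _.
elim: k => [|k IHk]; first by rewrite expr0 mulr0n cos0 sin0 oppr0.
rewrite exprS IHk mulrS cosD sinD; apply/eqP; rewrite eq_complex /=.
by rewrite mulrNN opprD !(mulrN, mulNr) (addrC (- _)) !eqxx.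
Qed.

Lemma omega_sum (R : realType) (r : nat) (j : 'I_r.+1) :
  \sum_(k < r.+1) omega R r.+1 ^+ (k * j) = (r.+1%:R *+ (j == 0) : R[i]).
Proof.
have [->|j0] := eqVneq j 0.
  under eq_bigr do rewrite muln0 expr0.
  by rewrite sumr_const card_ord.
under eq_bigr do rewrite mulnC exprM.
set w := _ ^+ j.
have wr : w ^+ r.+1 = 1.
  rewrite -exprM mulnC exprM.
  have -> : omega R r.+1 ^+ r.+1 = 1; last by rewrite expr1n.
  rewrite omegaX -mulr_natr divfK ?pnatr_eq0// mulr_natl.
  by rewrite cos2pi sin2pi oppr0.
suff w1 : w - 1 != 0.
  by apply: (mulfI w1); rewrite -subrX1 wr subrr mulr0.
rewrite subr_eq0 /w omegaX eq_complex /= negb_and.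
have -> : 2 * pi / r.+1%:R *+ j = (pi * (j%:R / r.+1%:R)) *+ 2 :> R.
  by rewrite -[LHS]mulr_natr -[RHS]mulr_natl !mulrA mulrAC.
set x := pi * _; have x0 : 0 < sin x.
  apply: sin_gt0_pi; rewrite mulr_gt0 ?pi_gt0 ?divr_gt0 ?ltr0n ?lt0n//=.
  by rewrite gtr_pMr ?pi_gt0// ltr_pdivrMr// mul1r ltr_nat ltn_ord.
have : cos x ^+ 2 < 1 by rewrite cos2sin2 gtrDl oppr_lt0 exprn_gt0.
by rewrite cos_mulr2n; lra.
Qed.

(* In a T-SVD the slices of dft S are the diagonal matrices of the singular
   values of the slices of dft A; tsigma i A is then the i-th diagonal entry
   of the first slice of S. *)
Lemma tsigma_tsvd (R : realType) (m n r : nat) (A S : tensor R m n r) :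
    (forall k, dft S k = \matrix_(i < m, j < n)
       ((sigma i.+1 (dft A k))%:C *+ (i == j :> nat))) ->
  forall (i : 'I_m) (j : 'I_n), i = j :> nat -> S 0 i j = tsigma i.+1 A.
Proof.
have r0 : r.+1%:R != 0 :> R by rewrite pnatr_eq0.
move=> SA i j ij; apply: (mulfI r0); rewrite /tsigma mulVKf//.
apply: complexI; rewrite rmorph_sum rmorphM/=.
under eq_bigr => k _.
  have /matrixP/(_ i j) := SA k; rewrite !mxE ij eqxx mulr1n => <-.
  rewrite summxE; under eq_bigr do rewrite !mxE.
  over.
rewrite exchange_big; under eq_bigr do rewrite -mulr_suml omega_sum.
rewrite (bigD1 0)//= big1 ?addr0; last first.
  by move=> l /negbTE->; rewrite mul0r.
by rewrite rmorph_nat.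
Qed.

(* Main.v *)
Require Import Defs.
From mathcomp Require Import all_boot all_order all_algebra.
From mathcomp Require Import complex zify reals trigo.

(** The Fourier transform along the third mode maps sums to slicewise sums, and
    A * B^T to the slicewise products of the slices of A with the adjoints
    of the slices of B ([dftD], [dft_tprod], [dft_ttr]). A tensor singular
    value is the average over the slices of ordinary singular values, so
    everything follows from the classical inequalities of Weyl and Ky Fan
    for complex matrices,
      sigma_(i+j-1) (A + B) <= sigma_i A + sigma_j B,
      sigma_(i+j-1) (A B^H) <= sigma_i A sigma_j B,
    where B^H is the adjoint of B. Sums pass to the average directly; for
    products, a sum of products of nonnegative numbers is at most the
    product of the sums, whence the factor equal to the number of slices
    ([tsigma_tprod]). The last two inequalities of the theorem are the case
    j = 1; the absolute value is handled by writing A = (A + B) - B.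

    The matrix inequalities rest on the low-rank characterization of
    singular values: sigma_i A <= c if and only if A is within distance c,
    in operator norm, of a matrix of rank less than i ([rank_approx_sigma],
    [sigma_le_rank_approx]). Its right-hand side, [rank_approx], is visibly
    compatible with the algebra. If M is close to X and N is close to Y,
    then M + N is close to X + Y, and
      M N = X N + (M - X) Y + (M - X) (N - Y)
    is close to X N + (M - X) Y, with ranks and distances that add and
    multiply as needed ([rank_approxD], [rank_approxM]); and adjoints
    preserve both rank and operator norm ([rank_approx_adj]).

    The characterization itself comes from the spectral theorem for A^H A.
    In an orthonormal eigenbasis, the square of the length of the image of
    a vector under A is the sum of the squares of its coordinates, weighted
    by the squared singular values ([sigma_gram]). Fewer than i singular
    values exceed sigma_i, and truncating A to the corresponding
    eigenvectors gives a good approximation ([rank_approx_few_large]).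
    Conversely, at least i of them are at least sigma_i, and a matrix of
    rank less than i kills a nonzero vector in the span of the
    corresponding eigenvectors, so it cannot be closer than sigma_i
    ([ge_rank_approx_many_large]). *)

Set Implicit Arguments.
Unset Strict Implicit.
Unset Printing Implicit Defensive.
Import Order.TTheory GRing.Theory Num.Theory.
Local Open Scope ring_scope.
Local Open Scope sesquilinear_scope.

(** * Approximation of matrices by matrices of small rank *)

Section LowRankApproximation.

Context {C : numClosedFieldType}.

Definition norm2 n (u : 'rV[C]_n) : C := sqrtC (dotmx u u).

Lemma norm2_ge0 n (u : 'rV[C]_n) : 0 <= norm2 u.
Proof. exact: sqrt_dnorm_ge0. Qed.

Lemma norm2_gt0 n (u : 'rV[C]_n) : (0 < norm2 u) = (u != 0).
Proof. exact: sqrt_dnorm_gt0. Qed.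

Lemma norm2D n (u v : 'rV[C]_n) : norm2 (u + v) <= norm2 u + norm2 v.
Proof. by have [] := triangle_lerif (@dotmx C n) u v. Qed.

Lemma CauchySchwarz_norm2 n (u v : 'rV[C]_n) :
  `|dotmx u v| <= norm2 u * norm2 v.
Proof. by have [] := CauchySchwarz_sqrt (@dotmx C n) u v. Qed.

Lemma dotmx_norm2 n (u : 'rV[C]_n) : dotmx u u = norm2 u ^+ 2.
Proof. by rewrite sqrtCK. Qed.

Lemma sqr_norm2 n (u : 'rV[C]_n) : norm2 u ^+ 2 = \sum_k `|u 0 k| ^+ 2.
Proof.
rewrite sqrtCK dotmxE mxE; apply: eq_bigr => k _.
by rewrite !mxE -normCK.
Qed.

Lemma ler_norm2 c m n (u : 'rV[C]_m) (v : 'rV[C]_n) : 0 <= c ->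
  (norm2 u <= c * norm2 v) = (norm2 u ^+ 2 <= c ^+ 2 * norm2 v ^+ 2).
Proof.
by move=> c0; rewrite -exprMn ler_sqr ?nnegrE ?mulr_ge0 ?norm2_ge0.
Qed.

(** Matrices act on rows, as in the library's treatment of row spaces. The
    operator norm is only ever used through its upper bounds, so no norm
    needs to be constructed. *)
Definition opbound c m n (M : 'M[C]_(m, n)) : Prop :=
  forall u : 'rV_m, norm2 (u *m M) <= c * norm2 u.

Lemma opboundD c d m n (M N : 'M[C]_(m, n)) :
  opbound c M -> opbound d N -> opbound (c + d) (M + N).
Proof.
move=> Mc Nd u; rewrite mulmxDr mulrDl.
exact: le_trans (norm2D _ _) (lerD (Mc u) (Nd u)).
Qed.

Lemma opboundM c d m n p (M : 'M[C]_(m, n)) (N : 'M[C]_(n, p)) : 0 <= d ->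
  opbound c M -> opbound d N -> opbound (c * d) (M *m N).
Proof.
move=> d0 Mc Nd u; rewrite mulmxA mulrAC mulrC.
exact: le_trans (Nd _) (ler_wpM2l d0 (Mc u)).
Qed.

Lemma mul_trC m n p (M : 'M[C]_(m, n)) (N : 'M[C]_(n, p)) :
  (M *m N)^t* = N^t* *m M^t*.
Proof. by rewrite trmx_mul map_mxM. Qed.

Lemma dotmx_adj m n (M : 'M[C]_(m, n)) (u : 'rV_n) (v : 'rV_m) :
  dotmx (u *m M^t*) v = dotmx u (v *m M).
Proof. by rewrite !dotmxE mul_trC !mulmxA. Qed.

Lemma dotmxMl m n (M : 'M[C]_(m, n)) (u : 'rV_m) (v : 'rV_n) :
  dotmx (u *m M) v = dotmx u (v *m M^t*).
Proof. by rewrite !dotmxE mul_trC trmxCK !mulmxA. Qed.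

(** Cauchy-Schwarz gives |w|^2 = <u, w M> <= |u| (c |w|) for w = u M^H, and |w|
    cancels. *)
Lemma opbound_adj c m n (M : 'M[C]_(m, n)) :
  0 <= c -> opbound c M -> opbound c (M^t*).
Proof.
move=> c0 Mc u; have [->|w0] := eqVneq (u *m M^t*) 0.
  by rewrite {1}/norm2 linear0l sqrtC0 mulr_ge0 ?norm2_ge0.
rewrite -norm2_gt0 in w0; set w := u *m M^t* in w0 *.
rewrite -(ler_pM2r w0).
have uw : dotmx u (w *m M) = norm2 w ^+ 2.
  by rewrite -dotmx_adj dotmx_norm2.
have := CauchySchwarz_norm2 u (w *m M).
rewrite uw ger0_norm ?exprn_ge0 ?norm2_ge0// expr2 => /le_trans; apply.
by rewrite mulrAC mulrC ler_wpM2r ?norm2_ge0.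
Qed.

(** For c >= 0, this says that the i-th singular value of M is at most c
    (Schmidt, Eckart, Young, Mirsky), in a form that mentions neither
    eigenvalues nor order. *)
Definition rank_approx c i m n (M : 'M[C]_(m, n)) : Prop :=
  exists2 X, (\rank X < i)%N & opbound c (M - X).

Lemma rank_approxD c d i j m n (M N : 'M[C]_(m, n)) :
  rank_approx c i M -> rank_approx d j N ->
  rank_approx (c + d) (i + j - 1) (M + N).
Proof.
move=> [X Xi Mc] [Y Yj Nd]; exists (X + Y).
  case: i Xi => // i Xi; rewrite addSn subn1/=.
  by apply: leq_ltn_trans (mxrank_add _ _) _; rewrite -addnS leq_add.
by rewrite opprD addrACA; apply: opboundD.
Qed.

Lemma mxrank_adj m n (M : 'M[C]_(m, n)) : \rank (M^t*) = \rank M.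
Proof. by rewrite mxrank_map mxrank_tr. Qed.

Lemma rank_approx_adj c i m n (M : 'M[C]_(m, n)) :
  0 <= c -> rank_approx c i M -> rank_approx c i (M^t*).
Proof.
move=> c0 [X Xi Mc]; exists (X^t*); first by rewrite mxrank_adj.
by rewrite -map_mxB -linearB; apply: opbound_adj.
Qed.

(** M N = (X N + (M - X) Y) + (M - X) (N - Y): the first bracket has rank at
    most rank X + rank Y, and the rest has norm at most c d. *)
Lemma rank_approxM c d i j m n p (M : 'M[C]_(m, n)) (N : 'M[C]_(n, p)) :
  0 <= d -> rank_approx c i M -> rank_approx d j N ->
  rank_approx (c * d) (i + j - 1) (M *m N).
Proof.
move=> d0 [X Xi Mc] [Y Yj Nd]; exists (X *m N + (M - X) *m Y).
  case: i Xi => // i Xi; rewrite addSn subn1/=.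
  apply: leq_ltn_trans (mxrank_add _ _) _; rewrite -addnS; apply: leq_add.
    exact: leq_trans (mxrankM_maxl _ _) Xi.
  exact: leq_ltn_trans (mxrankM_maxr _ _) Yj.
rewrite opprD addrA -mulmxBl -mulmxBr; exact: opboundM.
Qed.

Lemma rank_diag_indic n (K : pred 'I_n) :
  (\rank (diag_mx (\row_k (K k)%:R) : 'M[C]_n) <= #|K|)%N.
Proof.
rewrite (_ : diag_mx _ = \sum_(k in K) delta_mx k k); last first.
  apply/matrixP=> i j; rewrite !mxE summxE.
  have [Ki|Ki] := boolP (K i); last first.
    rewrite mul0rn big1// => k Kk; rewrite mxE.
    by case: eqP => // ik; rewrite ik -[K k]/(k \in K) Kk in Ki.
  rewrite (bigD1 i)//= mxE eqxx/= big1 ?addr0 1?eq_sym// => k /andP[_ ki].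
  by rewrite mxE eq_sym (negbTE ki).
rewrite -sum1_card; elim/big_ind2: _ => [|x a y b xa yb|k _].
- by rewrite mxrank0.
- exact: leq_trans (mxrank_add _ _) (leq_add xa yb).
- by rewrite mxrank_delta.
Qed.

Lemma norm2_unitary m n (P : 'M[C]_(m, n)) (u : 'rV_m) :
  P \is unitarymx -> norm2 (u *m P) = norm2 u.
Proof.
by move=> /unitarymxP PP; rewrite /norm2 dotmxMl -mulmxA PP mulmx1.
Qed.

Lemma sqr_norm2_gram m n (A : 'M[C]_(m, n)) (P : 'M_n) (d w : 'rV_n) :
    P \is unitarymx -> A^t* *m A = P^t* *m diag_mx d *m P ->
  norm2 (w *m P *m A^t*) ^+ 2 = \sum_k d 0 k * `|w 0 k| ^+ 2.
Proof.
move=> /unitarymxP PP AP; rewrite -dotmx_norm2 -dotmx_adj trmxCK -mulmxA AP.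
rewrite !mulmxA -[w *m P *m _]mulmxA PP mulmx1 dotmxMl -mulmxA PP mulmx1.
rewrite dotmxE mxE; apply: eq_bigr => k _.
by rewrite mul_mx_diag !mxE mulrAC -normCK mulrC.
Qed.

Lemma eigenvalues_diag n (M P : 'M[C]_n) d :
    P \in unitmx -> M = invmx P *m diag_mx d *m P ->
  perm_eq (eigenvalues M) [seq d 0 k | k <- enum 'I_n].
Proof.
move=> Pu ->; rewrite /eigenvalues; case: closed_field_poly_normal => s /=.
rewrite (monicP (char_poly_monic _)) scale1r => sE; apply: prod_XsubC_eq.
rewrite -{}sE big_map big_enum/=.
transitivity (char_poly (diag_mx d)); last first.
  rewrite char_poly_trig ?diag_mx_is_trig//.
  by apply: eq_bigr => k _; rewrite mxE eqxx mulr1n.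
have PP : map_mx polyC (invmx P) *m map_mx polyC P = 1%:M.
  by rewrite -map_mxM mulVmx// map_mx1.
rewrite /char_poly (_ : char_poly_mx (invmx P *m _ *m P) =
  map_mx polyC (invmx P) *m char_poly_mx (diag_mx d) *m map_mx polyC P);
  last first.
  rewrite mulmxBr mulmxBl scalar_mxC; congr (_ - _); last by rewrite !map_mxM.
  by rewrite -mulmxA PP mulmx1.
by rewrite !det_mulmx mulrAC -det_mulmx PP det1 mul1r.
Qed.

(** The rows of P are right singular vectors of A (conjugated), and the entries
    of d are the squared singular values, in no particular order. *)
Lemma gram_spectral m n (A : 'M[C]_(m, n)) :
  exists P : 'M_n, exists2 d : 'rV_n,
    P \is unitarymx /\ A^t* *m A = P^t* *m diag_mx d *m P &
    (forall k, 0 <= d 0 k) /\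
    perm_eq (eigenvalues (A^t* *m A)) [seq d 0 k | k <- enum 'I_n].
Proof.
have /orthomx_spectralP AP : A^t* *m A \is normalmx.
  by apply/normalmxP; rewrite mul_trC trmxCK.
set P := spectralmx _ in AP; set d := spectral_diag _ in AP.
have Pu : P \is unitarymx by exact: spectral_unitarymx.
have PE := eigenvalues_diag (unitarymx_unit Pu) AP.
rewrite (invmx_unitary Pu) in AP.
exists P, d; split=> // k.
have := sqr_norm2_gram 'e_k Pu AP.
rewrite (bigD1 k)//= big1 => [|l /negbTE lk]; last first.
  by rewrite mxE lk andbF normr0 expr0n mulr0.
rewrite mxE !eqxx normr1 expr1n mulr1 addr0 => <-.
by rewrite exprn_ge0 ?norm2_ge0.
Qed.

(** N stretches the rows of the orthonormal basis P by the factors s k, and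
    sends them to orthogonal vectors. If fewer than i of these factors
    exceed t, then truncating N to the corresponding basis vectors gives
    the approximation: what is left only meets factors that are at most t. *)
Lemma rank_approx_few_large n m (N : 'M[C]_(n, m)) (P : 'M_n)
    (s : 'I_n -> C) (K : pred 'I_n) t i :
    P \is unitarymx ->
    (forall w, norm2 (w *m P *m N) ^+ 2 = \sum_k s k ^+ 2 * `|w 0 k| ^+ 2) ->
    0 <= t -> (#|K| < i)%N -> (forall k, ~~ K k -> 0 <= s k <= t) ->
  rank_approx t i N.
Proof.
move=> Pu Ns t0 Ki Kt.
pose E : 'M[C]_n := diag_mx (\row_k (K k)%:R).
exists (P^t* *m E *m P *m N).
  apply: leq_ltn_trans (mxrankM_maxl _ _) _.
  apply: leq_ltn_trans (mxrankM_maxl _ _) _.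
  apply: leq_ltn_trans (mxrankM_maxr _ _) _.
  exact: leq_ltn_trans (@rank_diag_indic _ K) Ki.
move=> u; pose v := u *m P^t*.
have uE : v *m P = u by rewrite mulmxKtV.
have -> : u *m (N - P^t* *m E *m P *m N) = (v - v *m E) *m P *m N.
  by rewrite mulmxBr !mulmxA -/v !mulmxBl uE.
rewrite ler_norm2// -uE (norm2_unitary v Pu) (sqr_norm2 v) mulr_sumr Ns.
apply: ler_sum => k _; rewrite mul_mx_diag !mxE.
have [_|/Kt/andP[s0 st]] := boolP (K k).
  by rewrite mulr1 subrr normr0 expr0n mulr0 mulr_ge0 ?exprn_ge0.
by rewrite mulr0 subr0 ler_wpM2r ?exprn_ge0// lerXn2r.
Qed.

(** In the setting of the previous lemma, the basis vectors that N stretches by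
    at least t span a space of dimension at least i, so some nonzero vector
    of it is killed by X. On that vector N - X agrees with N, which
    stretches it by at least t. *)
Lemma ge_rank_approx_many_large n m (N : 'M[C]_(n, m)) (P : 'M_n)
    (s : 'I_n -> C) (K : pred 'I_n) t c i :
    P \is unitarymx ->
    (forall w, norm2 (w *m P *m N) ^+ 2 = \sum_k s k ^+ 2 * `|w 0 k| ^+ 2) ->
    0 <= c -> 0 <= t -> (forall k, K k -> t <= s k) -> (i <= #|K|)%N ->
  rank_approx c i N -> t <= c.
Proof.
move=> Pu Ns c0 t0 Kt iK [X Xi Xc].
pose E : 'M[C]_n := diag_mx (\row_k (predC K k)%:R).
(* A row w in the kernel of this block matrix vanishes outside K, and w P is
   killed by X; the two blocks impose fewer than n linear conditions. *)
have : (\rank (row_mx (P *m X) E) < n)%N.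
  rewrite -mxrank_tr tr_row_mx -addsmxE.
  apply: leq_ltn_trans (mxrank_adds_leqif _ _) _.
  rewrite !mxrank_tr -[X in (_ < X)%N](card_ord n) -(cardC K) -addSn.
  apply: leq_add (@rank_diag_indic _ (predC K)).
  exact: leq_trans (leq_ltn_trans (mxrankM_maxr _ _) Xi) iK.
rewrite ltn_neqAle -[_ == _]/(row_free _) -kermx_eq0.
move=> /andP[/rowV0Pn[w + w0] _].
rewrite sub_kermx mul_mx_row => /eqP/eqP; rewrite row_mx_eq0 mulmxA.
move=> /andP[/eqP wX /eqP wE].
have wn : 0 < norm2 w ^+ 2 by rewrite exprn_gt0// norm2_gt0.
have := Xc (w *m P); rewrite mulmxBr wX subr0 ler_norm2// Ns.
rewrite (norm2_unitary w Pu) => wc; rewrite -ler_sqr ?nnegrE// -(ler_pM2r wn).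
apply: le_trans wc; rewrite {1}sqr_norm2 mulr_sumr; apply: ler_sum => k _.
have [Kk|Kk] := boolP (K k).
  by rewrite ler_wpM2r ?exprn_ge0// lerXn2r ?nnegrE ?Kt// (le_trans t0) ?Kt.
have /rowP/(_ k) := wE; rewrite mul_mx_diag !mxE/= Kk mulr1 => ->.
by rewrite normr0 expr0n !mulr0.
Qed.

End LowRankApproximation.

(** * Singular values as distances to matrices of small rank *)

Section SingularValues.
Context {R : realType}.
Local Notation "x %:C" := (real_complex R x) : ring_scope.

(** Counting characterizes the i-th largest entry without a permutation that
    sorts the eigenbasis along with the eigenvalues. *)
Lemma sort_ge_nth (s : seq R) i : (i < size s)%N ->
  let t := (sort >=%R s)`_i in
  (count (fun x => t < x)%R s <= i)%N /\ (i < count (fun x => t <= x)%R s)%N.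
Proof.
move=> si t; have ss : sorted >=%R (sort >=%R s).
  by apply: sort_sorted => x y; apply: ge_total.
split; rewrite leqNgt; apply/negP => H.
  (* The counting lemmas are about increasing sequences: they are used for the
     dual order. *)
  have := @nth_count_lt _ R^d t 0 _ i ss.
  rewrite (permP (permEl (perm_sort _ _))) => /(_ H).
  by rewrite -/t ltxx.
have := @nth_count_gt _ R^d t 0 _ i ss.
rewrite (permP (permEl (perm_sort _ _))) size_sort si andbT => /(_ H).
by rewrite -/t ltxx.
Qed.

Lemma sigma_gram m n (A : 'M[R[i]]_(m, n)) :
  exists P : 'M_n, exists2 s : 'I_n -> R,
    P \is unitarymx /\
    (forall w, norm2 (w *m P *m A^t*) ^+ 2 =
               \sum_k (s k)%:C ^+ 2 * `|w 0 k| ^+ 2) &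
    (forall k, 0 <= s k) /\ forall i, (0 < i <= n)%N ->
      (#|[pred k | (sigma i A < s k)%R]| < i
         <= #|[pred k | (sigma i A <= s k)%R]|)%N.
Proof.
have [P [d [Pu AP] [d0 dA]]] := gram_spectral A.
pose s k := Num.sqrt (complex.Re (d 0 k)); exists P, s.
  split=> // w; rewrite (sqr_norm2_gram _ Pu AP); apply: eq_bigr => k _.
  congr (_ * _); rewrite -rmorphXn/= /s.
  have := d0 k; case: (d 0 k) => x y; rewrite lecE/= => /andP[/eqP-> x0].
  by rewrite sqr_sqrtr.
split=> [k|i /andP[i0 iN]]; first exact: sqrtr_ge0.
have sE : perm_eq
    [seq Num.sqrt (complex.Re x) | x <- eigenvalues (A^t* *m A)]
    [seq s k | k <- enum 'I_n].
  by rewrite (map_comp (fun x => Num.sqrt (complex.Re x)) (d 0)) perm_map.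
have [] := @sort_ge_nth [seq s k | k <- enum 'I_n] i.-1.
  by rewrite size_map size_enum_ord prednK.
have -> : (sort >=%R [seq s k | k <- enum 'I_n])`_i.-1 = sigma i A.
  congr (_`_ _); apply/esym/perm_sortP => //.
  - by move=> x y; apply: ge_total.
  - by move=> x y z /[swap]; apply: le_trans.
  - by move=> x y; rewrite andbC; apply: le_anti.
move: (sigma i A) => t; case: i i0 {iN} => // i _; rewrite !count_map => lo hi.
rewrite !cardE !size_filter ltnS; apply/andP; split; [exact: lo|exact: hi].
Qed.

Lemma sigma_ge0 m n i (A : 'M[R[i]]_(m, n)) : 0 <= sigma i A.
Proof.
rewrite /sigma; set s := sing_vals A.
have [si|/(nth_default 0)->//] := ltnP i.-1 (size s).
have : s`_i.-1 \in s by rewrite mem_nth.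
by rewrite mem_sort => /mapP[x _ ->]; apply: sqrtr_ge0.
Qed.

(** The two lemmas on stretching factors describe the map u |-> u A^H, since
    sigma is defined from A^H A. The row operator of A is its adjoint, for
    which the same approximations exist. *)
Lemma rank_approx_sigma m n i (A : 'M[R[i]]_(m, n)) : (0 < i <= n)%N ->
  rank_approx (sigma i A)%:C i A.
Proof.
move=> iN; have t0 : 0 <= (sigma i A)%:C by rewrite ler0c sigma_ge0.
have [P [s [Pu As] [s0 /(_ i iN)/andP[Ki _]]]] := sigma_gram A.
rewrite -[A]trmxCK; apply: rank_approx_adj; rewrite trmxCK//.
apply: rank_approx_few_large Pu As _ Ki _ => // k.
by rewrite -leNgt /= ler0c s0 lecR.
Qed.

Lemma sigma_le_rank_approx m n i (A : 'M[R[i]]_(m, n)) (c : R) :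
  (0 < i <= n)%N -> 0 <= c -> rank_approx c%:C i A -> sigma i A <= c.
Proof.
move=> iN c0; have cC : 0 <= c%:C by rewrite ler0c.
move=> /(rank_approx_adj cC) Ac.
have [P [s [Pu As] [s0 /(_ i iN)/andP[_ iK]]]] := sigma_gram A.
rewrite -lecR; apply: ge_rank_approx_many_large Pu As cC _ _ iK Ac => [|k].
  by rewrite ler0c sigma_ge0.
by rewrite lecR.
Qed.

End SingularValues.

(** * The Fourier transform turns tensor operations into slicewise ones *)

Section FourierSlices.
Context {R : realType} {r : nat}.
Local Notation w := (omega R r.+1).
Implicit Types i j k : 'I_r.+1.

Lemma omega_unity : w ^+ r.+1 = 1.
Proof.
rewrite omegaX -mulr_natr divfK ?pnatr_eq0// mulr_natl.
by rewrite cos2pi sin2pi oppr0.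
Qed.

Lemma omega_conj : w * w^* = 1.
Proof.
by rewrite -normCK normc_def/= sqrrN cos2Dsin2 sqrtr1 expr1n.
Qed.

(** The additions of 'I_r.+1 are modulo r.+1, so that each k gives a character
    of this group. *)
Lemma omegaX_add k i j : w ^+ (k * (i + j)%R) = w ^+ (k * i) * w ^+ (k * j).
Proof.
rewrite -exprD -mulnDr !(mulnC k) !exprM; congr (_ ^+ k).
exact: (expr_mod _ omega_unity).
Qed.

Lemma omegaX_opp k j : w ^+ (k * (- j)%R) = (w ^+ (k * j))^*.
Proof.
have ww : w ^+ (k * j) * (w ^+ (k * j))^* = 1.
  by rewrite rmorphXn/= -exprMn omega_conj expr1n.
have w0 : w ^+ (k * j) != 0.
  by apply: contra_eq_neq ww => ->; rewrite mul0r eq_sym oner_neq0.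
by apply: (mulfI w0); rewrite ww -omegaX_add subrr muln0.
Qed.

Lemma dftD m n (A B : tensor R m n r) k : dft (A + B) k = dft A k + dft B k.
Proof.
rewrite /dft -big_split; apply: eq_bigr => j _.
by rewrite ffunE map_mxD scalerDr.
Qed.

Lemma dftN m n (A : tensor R m n r) k : dft (- A) k = - dft A k.
Proof.
rewrite /dft -sumrN; apply: eq_bigr => j _.
by rewrite ffunE map_mxN scalerN.
Qed.

Lemma dft_tprod m n t (A : tensor R m n r) (B : tensor R n t r) k :
  dft (tprod A B) k = dft A k *m dft B k.
Proof.
rewrite /dft mulmx_sumr.
under eq_bigr do rewrite ffunE raddf_sum scaler_sumr.
rewrite exchange_big; apply: eq_bigr => l _; rewrite mulmx_suml.
rewrite (reindex_inj (addIr l)); apply: eq_bigr => j _.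
by rewrite addrK /= map_mxM omegaX_add -scalemxAl -scalemxAr scalerA.
Qed.

Lemma dft_ttr m n (A : tensor R m n r) k : dft (ttr A) k = (dft A k)^t*.
Proof.
rewrite /dft !raddf_sum (reindex_inj oppr_inj); apply: eq_bigr => j _.
rewrite ffunE opprK omegaX_opp; apply/matrixP=> x y; rewrite !mxE [RHS]rmorphM.
by congr (_ * _); rewrite -[RHS]/(conjc _) conjc_real.
Qed.

End FourierSlices.

(** * Inequalities for the singular values of the slices *)

Section SliceSingularValues.
Context {R : realType}.
Local Notation "x %:C" := (real_complex R x) : ring_scope.

Lemma sigmaD m n i j (A B : 'M[R[i]]_(m, n)) :
    (0 < i <= n)%N -> (0 < j <= n)%N -> (i + j - 1 <= n)%N ->
  sigma (i + j - 1) (A + B) <= sigma i A + sigma j B.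
Proof.
move=> iN jN ijN; apply: sigma_le_rank_approx; first by lia.
  by rewrite addr_ge0 ?sigma_ge0.
by rewrite rmorphD; apply: rank_approxD; apply: rank_approx_sigma.
Qed.

(** The bound on the index involves m because A B^H is a square matrix of size
    m. *)
Lemma sigmaM m n i j (A B : 'M[R[i]]_(m, n)) :
    (0 < i <= n)%N -> (0 < j <= n)%N -> (i + j - 1 <= m)%N ->
  sigma (i + j - 1) (A *m B^t*) <= sigma i A * sigma j B.
Proof.
move=> iN jN ijN; have tB : 0 <= (sigma j B)%:C by rewrite ler0c sigma_ge0.
apply: sigma_le_rank_approx; first by lia.
  by rewrite mulr_ge0 ?sigma_ge0.
rewrite rmorphM; apply: rank_approxM => //; first exact: rank_approx_sigma.
by apply: rank_approx_adj => //; apply: rank_approx_sigma.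
Qed.

Lemma sigmaN m n i (A : 'M[R[i]]_(m, n)) : sigma i (- A) = sigma i A.
Proof.
have AN : (- A)^t* = - A^t* by apply/matrixP=> x y; rewrite !mxE rmorphN.
by rewrite /sigma /sing_vals AN mulNmx mulmxN opprK.
Qed.

End SliceSingularValues.

(** * Averaging over the slices *)

Lemma tsigmaD (R : realType) (m n r i j : nat) (A B : tensor R m n r) :
    (0 < i <= n)%N -> (0 < j <= n)%N -> (i + j - 1 <= n)%N ->
  tsigma (i + j - 1) (A + B) <= tsigma i A + tsigma j B.
Proof.
move=> iN jN ijN; rewrite /tsigma -mulrDr -big_split.
rewrite ler_pM2l ?invr_gt0 ?ltr0n//; apply: ler_sum => k _.
by rewrite dftD; apply: sigmaD.
Qed.

Lemma tsigmaN (R : realType) (m n r i : nat) (A : tensor R m n r) :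
  tsigma i (- A) = tsigma i A.
Proof.
rewrite /tsigma; apply: (congr1 (fun x => _ * x)); apply: eq_bigr => k _.
by rewrite dftN; apply: sigmaN.
Qed.

(** The factor r.+1 in the bound comes from estimating a sum of products x_k
    y_k of nonnegative numbers by the product of the sums: the average of
    the x_k y_k is then at most r.+1 times the product of the averages. *)
Lemma tsigma_tprod (R : realType) (m n r i j : nat) (A B : tensor R m n r) :
    (0 < i <= n)%N -> (0 < j <= n)%N -> (i + j - 1 <= m)%N ->
  tsigma (i + j - 1) (tprod A (ttr B)) <= r.+1%:R * tsigma i A * tsigma j B.
Proof.
move=> iN jN ijN; rewrite /tsigma mulVKf ?pnatr_eq0// mulrCA.
rewrite ler_pM2l ?invr_gt0 ?ltr0n// mulr_suml; apply: ler_sum => k _.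
rewrite dft_tprod dft_ttr; apply: le_trans (sigmaM _ _ iN jN ijN) _.
rewrite ler_wpM2l ?sigma_ge0// (bigD1 k)//= lerDl sumr_ge0// => l _.
exact: sigma_ge0.
Qed.

Theorem theorem5p1 (R : realType) (m n r : nat) (m_gt0 : (0 < m)%N)
    (n_gt0 : (0 < n)%N) (A B : tensor R m n r) :
  [/\ forall i j : nat, (1 <= i <= minn m n)%N -> (1 <= j <= minn m n)%N ->
        (i + j - 1 <= minn m n)%N ->
        tsigma (i + j - 1) (A + B) <= tsigma i A + tsigma j B,
      forall i j : nat, (1 <= i <= minn m n)%N -> (1 <= j <= minn m n)%N ->
        (i + j - 1 <= minn m n)%N ->
        tsigma (i + j - 1) (tprod A (ttr B))
          <= r.+1%:R * tsigma i A * tsigma j B,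
      forall i : nat, (1 <= i <= minn m n)%N ->
        `|tsigma i (A + B) - tsigma i A| <= tsigma 1 B
    & forall i : nat, (1 <= i <= minn m n)%N ->
        tsigma i (tprod A (ttr B)) <= r.+1%:R * tsigma i A * tsigma 1 B].
Proof.
have Weyl i (X Y : tensor R m n r) : (1 <= i <= minn m n)%N ->
    tsigma i (X + Y) <= tsigma i X + tsigma 1 Y.
  by move=> iN; rewrite -{1}(addnK 1 i); apply: tsigmaD; lia.
split=> [i j iN jN ijN|i j iN jN ijN|i iN|i iN].
- by apply: tsigmaD; lia.
- by apply: tsigma_tprod; lia.
(* The lower bound is the upper one for A = (A + B) - B. *)
- have upper := Weyl i A B iN.
  have := Weyl i (A + B) (- B) iN; rewrite addrK tsigmaN => lower.
  move: (tsigma i (A + B)) (tsigma i A) (tsigma 1 B) upper lower => x y z.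
  by rewrite ler_distl lerBlDr => -> ->.
- by have := @tsigma_tprod R m n r i 1 A B; rewrite addnK; apply; lia.
Qed.
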